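(* Let $-\infty<a<b<\infty$, let $n$ be an odd integer and $m$ an integer with $3\le m\le n-1$, let $f\in\mathcal C^n([a,b])$, and let $g\in L$ be any function with $g(E)\subseteq[a,b]$ and $f\circ g\in L$. If $f$ is $n$-convex and $m$ is odd, then $$\begin{aligned}&(A(g)-a)\left(f[a,a]-f[a,b]\right)+\sum_{k=2}^{m-1}\frac{f^{(k)}(a)}{k!}A\left[(g-a\mathbf 1)^{k}\right]+\sum_{k=1}^{n-m}f[\underbrace{a,\dots,a}_{m\text{ times}};\underbrace{b,\dots,b}_{k\text{ times}}]\,A\left[(g-a\mathbf 1)^{m}(g-b\mathbf 1)^{k-1}\right]\\ &\le LR(f,g,a,b,A)\\ &\le (b-A(g))\left(f[a,b]-f[b,b]\right)+\sum_{k=2}^{m-1}\frac{f^{(k)}(b)}{k!}A\left[(g-b\mathbf 1)^{k}\right]+\sum_{k=1}^{n-m}f[\underbrace{b,\dots,b}_{m\text{ times}};\underbrace{a,\dots,a}_{k\text{ times}}]\,A\left[(g-b\mathbf 1)^{m}(g-a\mathbf 1)^{k-1}\right].\end{aligned}$$ The same inequalities also hold when $f$ is $n$-concave and $m$ is even. If $f$ is $n$-convex and $m$ is even, or if $f$ is $n$-concave and $m$ is odd, then both inequalities hold with the signs reversed.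
   Context: $E$ is a non-empty set; $L$ is a vector space (under pointwise operations) of functions $E\to\mathbb R$ containing the constant function $\mathbf 1$ (with $\mathbf 1(t)=1$ for all $t\in E$). $A\colon L\to\mathbb R$ is a positive linear functional (linear, and $A(h)\ge 0$ whenever $h\in L$ and $h(t)\ge0$ for all $t\in E$) with $A(\mathbf 1)=1$. Products and powers of functions are pointwise, and $(g-a\mathbf 1)^0=(g-b\mathbf 1)^0=\mathbf 1$. $$LR(f,g,a,b,A)=A(f\circ g)-\frac{b-A(g)}{b-a}f(a)-\frac{A(g)-a}{b-a}f(b).$$ Divided differences: for $f\in\mathcal C^n([a,b])$ and points $t_0\le t_1\le\dots\le t_k$ in $[a,b]$, $k\le n$, not necessarily distinct, $f[t_0,\dots,t_k]=f^{(k)}(t_0)/k!$ if $t_0=t_k$, and $f[t_0,\dots,t_k]=\dfrac{f[t_1,\dots,t_k]-f[t_0,\dots,t_{k-1}]}{t_k-t_0}$ otherwise. The value is taken to be independent of the order in which the points are listed; commas and semicolons both separate points. In particular $f[a,a]=f'(a)$ and $f[b,b]=f'(b)$. A function $f\colon[a,b]\to\mathbb R$ is $n$-convex if $f[t_0,\dots,t_n]\ge0$ for all choices of $n+1$ distinct points $t_0,\dots,t_n\in[a,b]$; it is $n$-concave if $-f$ is $n$-convex. *)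

(* Defs.v *)
From HB Require Import structures.
From mathcomp Require Import all_boot all_order all_algebra.
From mathcomp Require Import all_classical all_reals all_analysis.

Set Implicit Arguments.
Unset Strict Implicit.
Unset Printing Implicit Defensive.

Import Order.TTheory GRing.Theory Num.Theory numFieldNormedType.Exports.

Local Open Scope classical_set_scope.
Local Open Scope ring_scope.

(* A function on [a, b] is represented by a total function R -> R; no
   definition below looks at its values outside [a, b] (when applied to points
   of [a, b]). In particular the derivatives are those of the function on
   [a, b], hence one-sided at a and at b. *)

Section Derivatives.
Variables (R : realType) (a b : R).
Implicit Types (f : R -> R) (x : R).

Definition diffquot f x : R -> R := fun y => (f y - f x) / (y - x).

Definition derivable_on f x : Prop :=
  cvg (diffquot f x y @[y --> within `[a, b] x^']).

Definition derive_on f : R -> R :=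
  fun x => lim (diffquot f x y @[y --> within `[a, b] x^']).

Definition derive_on_n (k : nat) f : R -> R := iter k derive_on f.

Definition Cn_on (n : nat) f : Prop :=
  (forall k x, (k < n)%N -> x \in `[a, b] -> derivable_on (derive_on_n k f) x)
  /\ {within `[a, b], continuous (derive_on_n n f)}.

End Derivatives.

Section DividedDifferences.
Variables (R : realType) (a b : R).
Implicit Types (f : R -> R) (s : seq R).

(* f[t 0, ..., t k] for t 0 <= ... <= t k; for k = 0 the first branch is always
   taken and gives f (t 0). *)
Fixpoint divdiff_sorted f (k : nat) (t : nat -> R) : R :=
  if t k == t 0 then derive_on_n a b k f (t 0) / k`!%:R
  else if k is k'.+1 then
    (divdiff_sorted f k' (fun i => t i.+1) - divdiff_sorted f k' t)
      / (t k - t 0)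
  else 0.

(* Sorting the (nonempty) list of points makes the value independent of the
   order in which they are listed. *)
Definition divdiff f s : R :=
  divdiff_sorted f (size s).-1 (nth 0 (sort <=%R s)).

Definition nconvex (n : nat) f : Prop :=
  forall s, size s = n.+1 -> uniq s -> {in s, forall x, x \in `[a, b]} ->
    0 <= divdiff f s.

Definition nconcave (n : nat) f : Prop := nconvex n (fun x => - f x).

End DividedDifferences.

Section Functionals.
Variables (R : realType) (E : Type).
Implicit Types (L : set (E -> R)) (A : (E -> R) -> R).

(* The ring and module operations on E -> R are pointwise; cst 1 is the
   constant function 1. *)
Record function_space L : Prop := FunctionSpace {
  function_space_one : L (cst 1);
  function_space_lin : forall (c : R) u v, L u -> L v -> L (c *: u + v) }.

(* A functional on L is a total function on E -> R, only constrained on L. *)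
Record normalized_positive_functional L A : Prop := PositiveFunctional {
  functional_lin : forall (c : R) u v, L u -> L v ->
    A (c *: u + v) = c * A u + A v;
  functional_ge0 : forall h, L h -> (forall t, 0 <= h t) -> 0 <= A h;
  functional_one : A (cst 1) = 1 }.

Definition LR (f : R -> R) (g : E -> R) (a b : R) A : R :=
  A (f \o g) - (b - A g) / (b - a) * f a - (A g - a) / (b - a) * f b.

End Functionals.

(* Main.v *)
(* Newton's form of the Hermite interpolant of [f] at [c] ([m] times) and [d]
   ([n - m] times) gives, for [x] in [a, b],
     f x = (truncated Newton sum) + f[c^m, d^(n-m), x] (x - c)^m (x - d)^(n-m).
   Every divided difference of order [n] equals [f^(n)(xi) / n!] for some [xi]
   between the nodes, by Rolle's theorem with multiplicities. Applied to distinct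
   clustered nodes this shows that an [n]-convex [f] has [f^(n) >= 0]; applied to
   confluent nodes it then gives the sign of f[c^m, d^(n-m), x], so that the sign
   of the remainder is (-1)^(n-m) for (c, d) = (a, b) and (-1)^m for
   (c, d) = (b, a). Composing with [g] and applying the positive functional [A]
   yields both bounds. *)

Require Import Defs.
From HB Require Import structures.
From mathcomp Require Import all_boot all_order all_algebra.
From mathcomp Require Import all_classical all_reals all_analysis.
From mathcomp Require Import ring lra zify.

Import Order.TTheory GRing.Theory Num.Theory numFieldNormedType.Exports.

Local Open Scope classical_set_scope.
Local Open Scope ring_scope.

(** * Hermite interpolation and divided differences *)

(** Hermite conditions: the multiplicity of a node in [s] is the number of derivatives prescribed
    there, so distinct and confluent nodes are treated alike. A zero [J] expresses vanishing with
    multiplicity. *)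
Definition interpolates {R : realType} (J : R -> nat -> R) (s : seq R)
    (P : {poly R}) : Prop :=
  forall x k, (k < count_mem x s)%N -> P^`(k).[x] = J x k.

Definition jet {R : realType} (a b : R) f (x : R) (k : nat) : R :=
  derive_on_n a b k f x.

Definition nodal_poly {R : realType} (s : seq R) : {poly R} :=
  \prod_(y <- s) ('X - y%:P).

(** Leibniz's rule has only two terms, as ['X - y%:P] has degree one; for [k = 0] the truncated
    index [k.-1] is harmless because its factor [k%:R] is zero. *)
Lemma horner_derivn_mulXsubC {R : realType} (P : {poly R}) (y x : R) (k : nat) :
  (('X - y%:P) * P)^`(k).[x] = (x - y) * P^`(k).[x] + k%:R * P^`(k.-1).[x].
Proof.
suff -> : (('X - y%:P) * P)^`(k) = ('X - y%:P) * P^`(k) + P^`(k.-1) *+ k.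
  by rewrite hornerD hornerM !hornerE hornerMn -mulr_natl.
elim: k => [|k IHk]; first by rewrite mulr0n addr0.
rewrite derivnS IHk derivD derivM derivXsubC mul1r derivMn -!derivnS.
case: k {IHk} => [|k] /=; first by rewrite mulr0n addr0 addrC mulr1n.
rewrite -derivnS !mulrS; ring.
Qed.

Lemma derivn_size {R : realType} (P : {poly R}) (n : nat) :
  (size P <= n.+1)%N -> P^`(n) = (P`_n * n`!%:R)%:P.
Proof.
move=> szP; apply/polyP => i; rewrite coef_derivn coefC.
case: i => [|i] /=; first by rewrite addn0 ffactnn mulr_natr.
by rewrite nth_default ?mul0rn// (leq_trans szP)// addnS ltnS leq_addr.
Qed.

Lemma interpolatesB {R : realType} J J' (s : seq R) P Q :
  interpolates J s P -> interpolates J' s Q ->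
  interpolates (fun x k => J x k - J' x k) s (P - Q).
Proof. by move=> hP hQ x k hk; rewrite derivnB hornerD hornerN hP ?hQ. Qed.

Lemma interpolates0_mulXsubC {R : realType} (y : R) (s : seq R) P :
  interpolates (fun _ _ => 0) s P ->
  interpolates (fun _ _ => 0) (y :: s) (('X - y%:P) * P).
Proof.
move=> hP x k /=; rewrite horner_derivn_mulXsubC eq_sym.
have [->|xy] := eqVneq x y; last first.
  rewrite add0n => hk; rewrite !hP ?mulr0 ?addr0//.
  by rewrite (leq_ltn_trans (leq_pred k)).
rewrite subrr mul0r add0r add1n.
by case: k => [|k] hk /=; rewrite ?mul0r// hP ?mulr0.
Qed.

Lemma interpolates0_nodal {R : realType} (s : seq R) :
  interpolates (fun _ _ => 0) s (nodal_poly s).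
Proof.
elim: s => [|y s IHs]; first by move=> x k.
by rewrite /nodal_poly big_cons; apply: interpolates0_mulXsubC.
Qed.

(** The order of vanishing at [x] is exactly its multiplicity, which makes this value a legitimate
    denominator in [interpolates_extend]. *)
Lemma derivn_nodal_neq0 {R : realType} (x : R) (s : seq R) :
  (nodal_poly s)^`(count_mem x s).[x] != 0.
Proof.
elim: s => [|y s IHs] /=.
  by rewrite /nodal_poly big_nil hornerC oner_neq0.
rewrite /nodal_poly big_cons -/(nodal_poly s) horner_derivn_mulXsubC.
have [->|yx] := eqVneq y x.
  by rewrite subrr mul0r add0r add1n /= mulf_neq0// pnatr_eq0.
rewrite add0n; case E : (count_mem x s) IHs => [|k] /= IHs.
  by rewrite mul0r addr0 mulf_neq0// subr_eq0 eq_sym.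
rewrite [X in _ + _ * X]interpolates0_nodal ?E// mulr0 addr0.
by rewrite mulf_neq0// subr_eq0 eq_sym.
Qed.

Lemma size_nodal_poly {R : realType} (s : seq R) :
  size (nodal_poly s) = (size s).+1.
Proof. exact: size_prod_XsubC. Qed.

Lemma coef_nodal_poly {R : realType} (s : seq R) : (nodal_poly s)`_(size s) = 1.
Proof.
have /monicP := monic_prod_XsubC s predT id.
by rewrite /lead_coef -/(nodal_poly s) size_nodal_poly.
Qed.

(** Dividing by the linear factor of one node lowers both the size and the number of conditions by
    one. *)
Lemma interpolates0_eq0 {R : realType} (s : seq R) P :
  interpolates (fun _ _ => 0) s P -> (size P <= size s)%N -> P = 0.
Proof.
elim: s P => [|y s IHs] P hP; first by rewrite leqn0 size_poly_eq0 => /eqP.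
move=> /= szP.
have /factor_theorem [Q] : root P y.
  by apply/rootP; have := hP y 0%N; rewrite /= eqxx add1n => /(_ isT).
rewrite mulrC => PQ; have [Q0|Q0] := eqVneq Q 0; first by rewrite PQ Q0 mulr0.
suff QE : Q = 0 by rewrite QE eqxx in Q0.
apply: IHs; last first.
  by move: szP; rewrite PQ mulrC size_Mmonic ?monicXsubC// size_XsubC addn2.
move=> x; have [->|xy] := eqVneq x y => k hk.
  have := hP y k.+1; rewrite [count_mem _ _]/= eqxx add1n ltnS => /(_ hk).
  rewrite PQ horner_derivn_mulXsubC subrr mul0r add0r => /eqP.
  by rewrite mulf_eq0 pnatr_eq0 /= => /eqP.
elim: k hk => [|k IHk] hk.
  have := hP x 0%N; rewrite [count_mem _ _]/= eq_sym (negPf xy) add0n => /(_ hk).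
  rewrite PQ horner_derivn_mulXsubC mul0r addr0 => /eqP.
  by rewrite mulf_eq0 subr_eq0 (negPf xy) => /eqP.
have := hP x k.+1; rewrite [count_mem _ _]/= eq_sym (negPf xy) add0n => /(_ hk).
rewrite PQ horner_derivn_mulXsubC [k.+1.-1]/= IHk; last exact: ltnW.
rewrite mulr0 addr0 => /eqP.
by rewrite mulf_eq0 subr_eq0 (negPf xy) => /eqP.
Qed.

Lemma interpolates_uniq {R : realType} J (s : seq R) P Q :
  interpolates J s P -> interpolates J s Q ->
  (size P <= size s)%N -> (size Q <= size s)%N -> P = Q.
Proof.
move=> hP hQ szP szQ; apply/subr0_eq/(@interpolates0_eq0 _ s).
  by move=> x k hk; rewrite (interpolatesB _ _ _ _ _ hP hQ x k hk) subrr.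
by rewrite (leq_trans (size_polyD _ _))// geq_max szP size_polyN.
Qed.

Lemma interpolates_perm {R : realType} J (s t : seq R) P :
  perm_eq s t -> interpolates J s P -> interpolates J t P.
Proof. by move=> /permP st hP x k; rewrite -st; apply: hP. Qed.

(** Multiples of the nodal polynomial leave the old conditions intact; [c] is solved from the one
    new condition, of order [count_mem x s] at [x]. *)
Lemma interpolates_extend {R : realType} J (s : seq R) (x : R) P :
  interpolates J s P ->
  exists c, interpolates J (rcons s x) (P + c *: nodal_poly s).
Proof.
move=> hP; set m := count_mem x s.
exists ((J x m - P^`(m).[x]) / (nodal_poly s)^`(m).[x]) => y k.
rewrite -cats1 count_cat /= addn0 eq_sym derivnD derivnZ hornerD hornerZ.
have [|] := boolP (k < count_mem y s)%N => [hk _|].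
  by rewrite hP// [X in _ * X]interpolates0_nodal// mulr0 addr0.
rewrite -leqNgt; have [-> mk|yx] := eqVneq y x; last first.
  by rewrite addn0 => mk; rewrite ltnNge mk.
rewrite addn1 ltnS => km; have -> : k = m by apply/eqP; rewrite eqn_leq km mk.
by rewrite divfK ?derivn_nodal_neq0// addrC subrK.
Qed.

Lemma interpolates_exists {R : realType} J (s : seq R) :
  exists2 P : {poly R}, (size P <= size s)%N & interpolates J s P.
Proof.
elim/last_ind: s => [|s x [P szP hP]]; first by exists 0; rewrite ?size_poly0.
have [c hc] := interpolates_extend _ _ x _ hP.
exists (P + c *: nodal_poly s) => //; rewrite size_rcons.
rewrite (leq_trans (size_polyD _ _))// geq_max (leqW szP)/=.
by rewrite (leq_trans (size_scale_leq _ _))// size_nodal_poly.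
Qed.

(* Neville's recursion: comparing leading coefficients gives the recursion that
   defines divided differences. *)
Lemma interpolates_neville {R : realType} J (y z : R) (s : seq R) P Q :
  y != z -> interpolates J (rcons s z) P -> interpolates J (y :: s) Q ->
  interpolates J (y :: rcons s z)
    ((z - y)^-1 *: (('X - y%:P) * P - ('X - z%:P) * Q)).
Proof.
move=> yz hP hQ; have zy0 : z - y != 0 by rewrite subr_eq0 eq_sym.
have hPQ : interpolates (fun _ _ => 0) s (P - Q).
  move=> x k hk; rewrite derivnB hornerD hornerN hP ?hQ ?subrr//.
    by rewrite /= ltn_addl.
  by rewrite -cats1 count_cat ltn_addr.
set T := (X in interpolates _ _ X).
(* The same polynomial corrects [Q] by a term vanishing on [y :: s] and [P] by one vanishing on
   [z :: s]; the first form serves at [y], the second at every other node. *)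
have TQ : T = Q + (z - y)^-1 *: (('X - y%:P) * (P - Q)).
  apply: (scalerI zy0); rewrite scalerDr !scalerA mulfV// !scale1r.
  rewrite -mul_polyC polyCB; ring.
have TP : T = P + (z - y)^-1 *: (('X - z%:P) * (P - Q)).
  apply: (scalerI zy0); rewrite scalerDr !scalerA mulfV// !scale1r.
  rewrite -mul_polyC polyCB; ring.
move=> x k; rewrite /= -cats1 count_cat /= addn0.
have [<-|yx] := eqVneq y x.
  rewrite eq_sym (negPf yz) addn0 => hk.
  rewrite TQ derivnD derivnZ hornerD hornerZ hQ; last by rewrite /= eqxx.
  by rewrite (interpolates0_mulXsubC y _ _ hPQ) ?mulr0 ?addr0//= eqxx.
rewrite add0n => hk.
rewrite TP derivnD derivnZ hornerD hornerZ hP; last first.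
  by rewrite -cats1 count_cat /= addn0.
rewrite (interpolates0_mulXsubC z _ _ hPQ) ?mulr0 ?addr0//=.
by rewrite addnC.
Qed.

(** * Divided differences as coefficients of interpolants *)

Lemma divdiff_sortedS {R : realType} (a b : R) f (k : nat) (t : nat -> R) :
  divdiff_sorted a b f k.+1 t =
  if t k.+1 == t 0%N then derive_on_n a b k.+1 f (t 0%N) / k.+1`!%:R
  else (divdiff_sorted a b f k (fun i => t i.+1) - divdiff_sorted a b f k t)
         / (t k.+1 - t 0%N).
Proof. by []. Qed.

(** If the extreme nodes coincide, monotonicity makes all nodes equal and the coefficient is a
    Taylor coefficient; otherwise the recursion is Neville's. *)
Lemma coef_divdiff_sorted {R : realType} (a b : R) f (k : nat) (t : nat -> R)
    (P : {poly R}) :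
  (forall i j, (i <= j <= k)%N -> t i <= t j) -> (size P <= k.+1)%N ->
  interpolates (jet a b f) (mkseq t k.+1) P ->
  P`_k = divdiff_sorted a b f k t.
Proof.
elim: k t P => [|k IHk] t P tmono szP hP.
  have := hP (t 0%N) 0%N; rewrite /jet /= !eqxx => /(_ isT) <-.
  by rewrite (size1_polyC szP) coefC hornerC /= divr1.
rewrite divdiff_sortedS; have [tk0|tk0] := eqVneq (t k.+1) (t 0%N).
  have te i : (i <= k.+1)%N -> t i = t 0%N.
    by move=> ik; apply/eqP; rewrite eq_le -{1}tk0 !tmono ?ik ?leqnn.
  have := hP (t 0%N) k.+1.
  have -> : mkseq t k.+2 = nseq k.+2 (t 0%N).
    apply: (@eq_from_nth _ 0) => [|i]; rewrite size_mkseq ?size_nseq// => ik.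
    by rewrite nth_mkseq// nth_nseq ik te.
  rewrite /jet count_nseq [pred1 _ _]/= eqxx mul1n => /(_ (leqnn _)) <-.
  by rewrite derivn_size// hornerC mulfK// pnatr_eq0 -lt0n fact_gt0.
have [P1 szP1 hP1] := interpolates_exists
  (jet a b f) (mkseq (fun i => t i.+1) k.+1).
have [P2 szP2 hP2] := interpolates_exists
  (jet a b f) (mkseq t k.+1).
rewrite size_mkseq in szP1; rewrite size_mkseq in szP2.
rewrite -(IHk _ _ _ szP1 hP1); last by move=> i j ij; apply: tmono; lia.
rewrite -(IHk _ _ _ szP2 hP2); last by move=> i j ij; apply: tmono; lia.
set s := mkseq (fun i => t i.+1) k.
have mkseq_head l : mkseq t l.+1 = t 0%N :: mkseq (fun i => t i.+1) l.
  by rewrite /mkseq /= -[1%N]/(1 + 0)%N iotaDl -map_comp.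
rewrite mkseqS -/s in hP1; rewrite mkseq_head -/s in hP2.
rewrite mkseq_head mkseqS -/s in hP.
have hT : t 0%N != t k.+1 by rewrite eq_sym.
have /interpolates_uniq := interpolates_neville _ _ _ _ _ _ hT hP1 hP2.
move=> /(_ _ hP) <- //; last by rewrite /= size_rcons size_mkseq.
  rewrite [RHS]mulrC coefZ coefB; congr (_ * _).
  (* Both interpolants have size at most [k.+1], so only their products with ['X] reach degree
     [k.+1]. *)
  rewrite !(mulrBl, coefB) !coefXM !coefCM /=.
  by rewrite (nth_default _ szP1) (nth_default _ szP2) !mulr0 !subr0.
rewrite /= size_rcons size_mkseq (leq_trans (size_scale_leq _ _))//.
rewrite (leq_trans (size_polyD _ _))// size_polyN geq_max.
by rewrite !(leq_trans (size_polyMleq _ _))// size_XsubC /= ltnS.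
Qed.

(** Interpolation conditions depend only on multiplicities, so sorting the nodes changes nothing. *)
Lemma coef_divdiff {R : realType} (a b : R) f (s : seq R) (P : {poly R}) :
  (0 < size s)%N -> (size P <= size s)%N ->
  interpolates (jet a b f) s P ->
  P`_(size s).-1 = divdiff a b f s.
Proof.
move=> s0 szP hP; apply: coef_divdiff_sorted; rewrite ?prednK//.
  move=> i j /andP[ij js]; apply: sorted_leq_nth => //.
  - exact: le_trans.
  - exact: sort_le_sorted.
  - by rewrite inE size_sort -(prednK s0) ltnS (leq_trans ij).
  - by rewrite inE size_sort -(prednK s0) ltnS.
apply: interpolates_perm hP.
by rewrite -(size_sort <=%R s) mkseq_nth perm_sym perm_sort.
Qed.

(** The nodal polynomial is monic of degree [size s], above that of [P], so the factor of the
    correction is the coefficient of [Q] in that degree. *)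
Lemma interpolates_rcons {R : realType} (a b : R) f (s : seq R) (x : R)
    (P Q : {poly R}) :
  interpolates (jet a b f) s P ->
  (size P <= size s)%N ->
  interpolates (jet a b f) (rcons s x) Q ->
  (size Q <= (size s).+1)%N ->
  Q = P + divdiff a b f (rcons s x) *: nodal_poly s.
Proof.
move=> hP szP hQ szQ; have [c hc] := interpolates_extend _ _ x _ hP.
have szc : (size (P + c *: nodal_poly s)%R <= (size s).+1)%N.
  rewrite (leq_trans (size_polyD _ _))// geq_max (leqW szP)/=.
  by rewrite (leq_trans (size_scale_leq _ _))// size_nodal_poly.
rewrite (interpolates_uniq _ _ _ _ hQ hc) ?size_rcons//.
have := coef_divdiff _ _ _ (rcons s x) _ _ _ hc.
rewrite size_rcons /= => /(_ isT szc) <-.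
by rewrite coefD coefZ coef_nodal_poly (nth_default _ szP) add0r mulr1.
Qed.

Lemma take_rcons {T : Type} (s : seq T) (x : T) (i : nat) :
  (i <= size s)%N -> take i (rcons s x) = take i s.
Proof. by move=> si; rewrite -cats1 takel_cat. Qed.

Lemma interpolates_newton {R : realType} (a b : R) f (s : seq R) (P : {poly R}) :
  interpolates (jet a b f) s P ->
  (size P <= size s)%N ->
  P = \sum_(i < size s)
        divdiff a b f (take i.+1 s) *: nodal_poly (take i s).
Proof.
elim/last_ind: s P => [|s x IHs] Q hQ szQ.
  by rewrite big_ord0; apply/eqP; rewrite -size_poly_leq0.
have [P szP hP] := interpolates_exists (jet a b f) s.
rewrite size_rcons in szQ; rewrite (interpolates_rcons _ _ _ _ _ _ _ hP szP hQ szQ).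
rewrite size_rcons big_ord_recr /= (IHs _ hP szP); congr (_ + _).
  by apply: eq_bigr => i _; rewrite !take_rcons ?(ltnW (ltn_ord i)).
by rewrite take_oversize ?size_rcons// take_rcons// take_size.
Qed.

(** Appending [x] as a node makes the interpolant exact at [x]; the last Newton term is then the
    remainder. *)
Lemma newton_formula {R : realType} (a b : R) f (s : seq R) (x : R) :
  f x = \sum_(i < size s)
          divdiff a b f (take i.+1 s) * (nodal_poly (take i s)).[x]
        + divdiff a b f (rcons s x) * (nodal_poly s).[x].
Proof.
have [P szP hP] := interpolates_exists (jet a b f) (rcons s x).
have := hP x 0%N; rewrite /jet -cats1 count_cat /= eqxx addn1 => /(_ isT) <-.
rewrite (interpolates_newton _ _ _ _ _ hP szP) size_rcons big_ord_recr /=.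
rewrite hornerD hornerZ horner_sum; congr (_ + _).
  by apply: eq_bigr => i _; rewrite hornerZ !take_rcons ?(ltnW (ltn_ord i)).
by rewrite take_oversize ?size_rcons// take_rcons// take_size cats1.
Qed.

(** * Rolle's theorem with multiplicities *)

Lemma derivable_on_cvg {R : realType} (a b : R) f x :
  derivable_on a b f x ->
  diffquot f x y @[y --> within `[a, b] x^'] --> derive_on a b f x.
Proof. by []. Qed.

Lemma derivable_on_continuous {R : realType} (a b : R) f x :
  derivable_on a b f x -> f @ within `[a, b] (nbhs x) --> f x.
Proof.
move=> /derivable_on_cvg fx.
have cx : y - x @[y --> within `[a, b] x^'] --> x - x.
  apply: cvgB; last exact: cvg_cst.
  by apply: cvg_within_filter; apply: cvg_within_filter; exact: cvg_id.
have cf : f y @[y --> within `[a, b] x^'] --> f x.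
  rewrite -[X in _ --> X]addr0 -(mulr0 (derive_on a b f x)) -(subrr x).
  apply: cvg_trans (cvgD (cvg_cst (f x)) (cvgM fx cx)).
  apply: near_eq_cvg; rewrite !near_withinE; near=> y => yx _.
  by rewrite -[LHS]/(f x + (f y - f x) / (y - x) * (y - x)) divfK ?subr_eq0// addrC subrK.
move=> U Ufx.
have hU : \forall y \near x, y != x -> `[a, b]%classic y -> U (f y) := cf U Ufx.
suff : \forall y \near x, `[a, b]%classic y -> U (f y) by [].
apply: filterS hU => y hy ay.
by have [->|yx] := eqVneq y x; [exact: nbhs_singleton|exact: hy].
Unshelve. all: by end_near. Qed.

(** At an interior point [h + x] stays in [[a, b]] for small [h], so the restricted and ordinary
    difference quotients have the same limit. This gives access to the ordinary Rolle theorem. *)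
Lemma derivable_on_is_derive {R : realType} (a b : R) f x :
  x \in `]a, b[ -> derivable_on a b f x ->
  is_derive x 1 f (derive_on a b f x).
Proof.
move=> xab /derivable_on_cvg fx.
suff fl : h^-1 *: ((f \o shift x) (h *: 1) - f x) @[h --> 0^']
          --> derive_on a b f x.
  by apply: DeriveDef; [apply/cvg_ex; exists (derive_on a b f x)|exact/cvg_lim].
have cx : h + x @[h --> (0 : R)^'] --> within `[a, b] x^'.
  move=> U xU'.
  have xU : \forall y \near x, y != x -> `[a, b]%classic y -> U y := xU'.
  suff : \forall h \near (0 : R), h != 0 -> U (h + x) by [].
  have hx : h + x @[h --> (0 : R)] --> x.
    rewrite -[X in _ --> X]add0r; apply: cvgD; [exact: cvg_id|exact: cvg_cst].
  have hU : \forall h \near (0 : R),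
    h + x != x -> `[a, b]%classic (h + x) -> U (h + x) := hx _ xU.
  have hab : \forall h \near (0 : R), h + x \in `]a, b[ := hx _ (near_in_itvoo xab).
  apply: filterS2 hU hab => h /= hUh habh h0.
  apply: hUh => //; first by rewrite -subr_eq0 addrK.
  exact: subset_itv_oo_cc.
apply: cvg_trans (cvg_comp _ _ cx fx).
apply: near_eq_cvg; near=> h.
by rewrite -[RHS]/(h^-1 * (f (h * 1 + x) - f x)) /= /diffquot addrK mulr1 mulrC.
Unshelve. all: by end_near. Qed.

(* [phi k] plays the role of the [k]-th derivative of a function. *)
Definition derivative_chain {R : realType} (a b : R) (n : nat)
    (phi : nat -> R -> R) : Prop :=
  (forall k, (k <= n)%N -> {within `[a, b], continuous (phi k)}) /\
  (forall k x, (k < n)%N -> x \in `]a, b[ -> is_derive x 1 (phi k) (phi k.+1 x)).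

Definition vanishes_on {R : realType} (phi : nat -> R -> R) (s : seq R) : Prop :=
  forall x k, (k < count_mem x s)%N -> phi k x = 0.

Lemma rolle_chain {R : realType} (a b : R) (n : nat) phi (x y : R) :
  derivative_chain a b n.+1 phi -> x \in `[a, b] -> y \in `[a, b] -> x < y ->
  phi 0%N x = 0 -> phi 0%N y = 0 -> exists2 z, x < z < y & phi 1%N z = 0.
Proof.
move=> [phic phid]; rewrite !in_itv /= => /andP[ax _] /andP[_ yb] xy x0 y0.
have sub z : z \in `]x, y[ -> z \in `]a, b[.
  by rewrite !in_itv /= => /andP[xz zy]; rewrite (le_lt_trans ax)// (lt_le_trans zy).
have [z /sub zab|||z zxy dz] := @Rolle _ (phi 0%N) _ _ xy.
- by have [] := phid 0%N z isT zab.
- apply: continuous_subspaceW (phic 0%N isT) => z /=.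
  rewrite !in_itv /= => /andP[xz zy].
  by rewrite (le_trans ax)// (le_trans zy).
- by rewrite x0 y0.
exists z; first by move: zxy; rewrite in_itv.
have [_ <-] := phid 0%N z isT (sub _ zxy).
by have [_ ->] := dz.
Qed.

(* [t] keeps every node with its multiplicity lowered by one and gains a Rolle
   point in each gap between two consecutive distinct nodes. *)
Lemma rolle_zeros {R : realType} (a b : R) (n : nat) phi (x : R) (s : seq R) :
  derivative_chain a b n.+1 phi -> path <=%R x s ->
  {in x :: s, forall y, y \in `[a, b]} ->
  vanishes_on phi (x :: s) ->
  exists t : seq R, [/\ size t = size s, sorted <=%R t,
    {in t, forall y, x <= y <= last x s},
    {in x :: s, forall y, (count_mem y t < count_mem y (x :: s))%N} &
    {in t, forall y, y \notin x :: s -> count_mem y t = 1%N /\ phi 1%N y = 0}].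
Proof.
move=> hphi; elim: s x => [|y s IHs] x xs sab hv.
  exists [::]; split => // y.
  by rewrite inE => /eqP ->; rewrite /= eqxx.
move: xs => /= /andP[xy ys].
have ysP z : z \in y :: s -> y <= z.
  rewrite inE => /orP[/eqP ->//|]; apply/allP; exact: order_path_min le_trans ys.
have [z zys|z k zk|t [szt st tb ht1 ht2]] := IHs y ys.
- by apply: sab; rewrite inE zys orbT.
- by apply: hv; rewrite (leq_trans zk)//= leq_addl.
move: xy; rewrite le_eqVlt => /orP[/eqP xy|xy].
  (* A repeated node opens no gap: the extra copy of [x] raises its count by one in both lists. *)
  exists (x :: t); split => /=.
  - by rewrite szt.
  - rewrite path_min_sorted//; apply/allP => z /tb; rewrite xy.
    by case/andP.
  - move=> z; rewrite inE => /orP[/eqP ->|/tb]; last by rewrite xy.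
    by rewrite lexx xy ysP ?mem_last.
  - move=> z zxs; rewrite ltn_add2l; apply: ht1.
    by move: zxs; rewrite inE xy => /orP[/eqP ->|//]; rewrite inE eqxx.
  - move=> z; rewrite !inE => /orP[/eqP ->|zt]; rewrite ?eqxx//.
    by rewrite eq_sym => /norP[/negPf -> zs]; apply: ht2; rewrite // inE.
have [z /andP[xz zy] hz] : exists2 z, x < z < y & phi 1%N z = 0.
  apply: (rolle_chain _ _ _ _ _ _ hphi) => //.
  - by apply: sab; rewrite inE eqxx.
  - by apply: sab; rewrite !inE eqxx orbT.
  - by apply: hv; rewrite /= eqxx.
  - by apply: hv; rewrite /= eqxx addnCA.
(* All of [t] lies at or beyond [y], so the Rolle point [z] goes first and occurs only once. *)
have tz w : w \in t -> z < w by move=> /tb /andP[yw _]; exact: lt_le_trans yw.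
exists (z :: t); split => /=.
- by rewrite szt.
- by rewrite path_min_sorted//; apply/allP => w /tz /ltW.
- move=> w; rewrite inE => /orP[/eqP ->|/tb /andP[yw ->]].
    by rewrite (ltW xz) (le_trans (ltW zy))// ysP ?mem_last.
  by rewrite andbT (le_trans _ yw)// (ltW (lt_trans xz zy)).
- move=> w; rewrite inE; have [->|wx] /= := eqVneq w x.
    rewrite (gt_eqF xz) (count_memPn _) ?addn0 ?eqxx//.
    by apply/negP => /tz; rewrite ltNge (ltW xz).
  move=> wys; rewrite (lt_eqF (lt_le_trans zy (ysP _ wys))).
  by rewrite !add0n; exact: ht1.
- move=> w; rewrite !inE => /orP[/eqP -> _|wt /norP[wx wys]].
    by rewrite eqxx (count_memPn _)//; apply/negP => /tz; rewrite ltxx.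
  by rewrite (lt_eqF (tz _ wt)); apply: ht2; rewrite ?inE.
Qed.

(** Each pass of [rolle_zeros] trades one zero for one order of differentiation; after [n] passes
    one zero remains. The bounds [p] and [q] record where it lies. *)
Lemma rolle_vanishing {R : realType} (a b : R) (n : nat) phi (s : seq R) (p q : R) :
  derivative_chain a b n phi -> (size s = n.+1)%N -> sorted <=%R s ->
  {in s, forall y, y \in `[a, b]} -> {in s, forall y, p <= y <= q} ->
  vanishes_on phi s ->
  exists x, [/\ x \in `[a, b], p <= x <= q & phi n x = 0].
Proof.
elim: n phi s => [|n IHn] phi [//|x s] hphi [szs] sx sab spq hv.
  exists x; rewrite sab ?spq ?hv ?inE//= ?eqxx//.
have [t [szt st tb ht1 ht2]] := rolle_zeros _ _ _ _ _ _ hphi sx sab hv.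
have sI (P : R -> Prop) : {in x :: s, forall y, P y} -> P x /\ P (last x s).
  by move=> h; split; apply: h; rewrite ?mem_last// inE eqxx.
apply: (IHn (fun k => phi k.+1) t) => //.
- by split=> [k kn|k y kn]; [exact: hphi.1|exact: hphi.2].
- by rewrite szt.
- have [] := sI _ sab; rewrite !in_itv /= => /andP[ax _] /andP[_ lb].
  move=> y /tb /andP[xy yl]; rewrite in_itv /=.
  by rewrite (le_trans ax xy) (le_trans yl lb).
- have [/andP[px _] /andP[_ lq]] := sI _ spq.
  by move=> y /tb /andP[xy yl]; rewrite (le_trans px xy) (le_trans yl lq).
(* At an old node the count has dropped, so order [k] of the shifted chain is order [k.+1] of [phi],
   still within the multiplicity; a new point has count one, which forces [k = 0]. *)
move=> y k kt; have [ys|ys] := boolP (y \in x :: s).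
  by apply: hv; apply: leq_ltn_trans kt (ht1 _ ys).
have yt : y \in t by rewrite -has_pred1 has_count (leq_ltn_trans _ kt).
by have [t1] := ht2 _ yt ys; move: kt; rewrite t1 ltnS leqn0 => /eqP ->.
Qed.

Lemma derive_on_n_chain {R : realType} (a b : R) (n : nat) f (P : {poly R}) :
  Cn_on a b n f ->
  derivative_chain a b n (fun k x => derive_on_n a b k f x - P^`(k).[x]).
Proof.
move=> [fd fc]; split=> [k|k x kn xab].
  rewrite leq_eqVlt => kn x.
  have cf : {within `[a, b], continuous (derive_on_n a b k f)}.
    case/orP: kn => [/eqP ->//|kn].
    by apply/subspace_continuousP => y yab; apply/derivable_on_continuous/fd.
  apply: cvgB; first exact: cf.
  exact: (continuous_subspaceT (@continuous_horner _ P^`(k))).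
have dx := derivable_on_is_derive _ _ _ _ xab
  (fd _ _ kn (subset_itv_oo_cc xab)).
rewrite derivnS; exact: is_deriveB.
Qed.

(** The error [f - P] vanishes at all nodes, so its [n]-th derivative has a zero, while that of [P]
    is constantly [n!] times its coefficient of degree [n]. The location in [[p, q]] serves
    [derive_on_n_sign]. *)
Lemma divdiff_mean_value {R : realType} (a b : R) (n : nat) f (s : seq R) (p q : R) :
  Cn_on a b n f -> size s = n.+1 ->
  {in s, forall y, y \in `[a, b]} -> {in s, forall y, p <= y <= q} ->
  exists x, [/\ x \in `[a, b], p <= x <= q &
                divdiff a b f s = derive_on_n a b n f x / n`!%:R].
Proof.
move=> fCn szs sab spq; have [P szP hP] := interpolates_exists (jet a b f) s.
have ms : sort <=%R s =i s by apply: perm_mem; rewrite perm_sort.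
have [|||||x [xab xpq /subr0_eq hx]] := rolle_vanishing _ _ n _ (sort <=%R s) p q
  (derive_on_n_chain _ _ _ _ P fCn).
- by rewrite size_sort.
- exact: sort_le_sorted.
- by move=> y; rewrite ms; apply: sab.
- by move=> y; rewrite ms; apply: spq.
- move=> y k; rewrite count_sort => /hP ->; exact: subrr.
have := coef_divdiff _ _ _ s _ _ szP hP; rewrite szs /= => /(_ isT) <-.
exists x; split=> //; rewrite hx derivn_size -?szs// hornerC.
by rewrite mulfK// pnatr_eq0 -lt0n fact_gt0.
Qed.

(** * Sign of the divided differences *)

(** With strictly increasing nodes the recursion ends at single points, so [f] enters only through
    its values. *)
Lemma divdiff_sorted_opp {R : realType} (a b : R) f (k : nat) (t : nat -> R) :
  (forall i j, (i < j <= k)%N -> t i < t j) ->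
  divdiff_sorted a b (fun x => - f x) k t = - divdiff_sorted a b f k t.
Proof.
elim: k t => [|k IHk] t tmono; first by rewrite /= eqxx mulNr.
rewrite !divdiff_sortedS gt_eqF ?tmono ?leqnn//.
rewrite !IHk => [|i j ij|i j ij]; [|by apply: tmono; lia|by apply: tmono; lia].
by rewrite -opprD mulNr.
Qed.

Lemma divdiff_opp {R : realType} (a b : R) f (s : seq R) :
  uniq s -> (0 < size s)%N ->
  divdiff a b (fun x => - f x) s = - divdiff a b f s.
Proof.
move=> us s0; apply: divdiff_sorted_opp => i j /andP[ij js].
apply: sorted_ltn_nth => //; first exact: lt_trans.
- by rewrite sort_lt_sorted.
- by rewrite inE size_sort -(prednK s0) ltnS (leq_trans _ js)// ltnW.
- by rewrite inE size_sort -(prednK s0) ltnS.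
Qed.

(** The factor [sigma], later [1] or [-1], treats convexity and concavity together. A negative value
    at [c] would persist nearby, and nodes clustered there would have a divided difference of the
    wrong sign. *)
Lemma derive_on_n_sign {R : realType} (a b : R) (n : nat) f (sigma : R) :
  a < b -> Cn_on a b n f ->
  (forall s, size s = n.+1 -> uniq s -> {in s, forall x, x \in `[a, b]} ->
    0 <= sigma * divdiff a b f s) ->
  {in `[a, b], forall x, 0 <= sigma * derive_on_n a b n f x}.
Proof.
move=> ab fCn hs c cab; rewrite leNgt; apply/negP => hc.
have cf : sigma * derive_on_n a b n f x @[x --> within `[a, b] (nbhs c)]
    --> sigma * derive_on_n a b n f c.
  apply: cvgM; first exact: cvg_cst.
  by move/subspace_continuousP: fCn.2; apply.
have hn : \forall y \near c, `[a, b]%classic y -> sigma * derive_on_n a b n f y < 0.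
  by have := cvgr_lt _ cf _ hc; apply.
have [e /= e0 he] := (nbhs_ballP _ _).1 hn.
have e2 : 0 < e / 2 by rewrite divr_gt0.
move: (cab); rewrite in_itv /= => /andP[ac cb].
(* Clipping to [[a, b]] allows [c] to be an endpoint; the half radius keeps the closed interval
   [[p, q]] inside the open ball. *)
pose p := Num.max a (c - e / 2); pose q := Num.min b (c + e / 2).
have pq : p < q by rewrite gt_max !lt_min ab /=; apply/and3P; split; lra.
have [ap qb] : a <= p /\ q <= b by rewrite le_max ge_min !lexx.
pose s := mkseq (fun i => p + (q - p) * (i%:R / n.+1%:R)) n.+1.
have us : uniq s.
  apply/mkseq_uniqP => i j _ _ /addrI /mulfI; rewrite subr_eq0 gt_eqF// => /(_ isT).
  by move=> /divIf; rewrite pnatr_eq0 => /(_ isT) /eqP; rewrite eqr_nat => /eqP.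
have spq : {in s, forall y, p <= y <= q}.
  move=> y /mapP[i]; rewrite mem_iota add0n => /andP[_ ni] ->.
  have i0 : 0 <= i%:R / n.+1%:R :> R by rewrite divr_ge0.
  have i1 : i%:R / n.+1%:R <= 1 :> R by rewrite ler_pdivrMr// mul1r ler_nat ltnW.
  have qp0 : 0 <= q - p by rewrite subr_ge0 ltW.
  by rewrite lerDl mulr_ge0//= -lerBrDl ler_piMr.
have sab : {in s, forall y, y \in `[a, b]}.
  move=> y /spq /andP[py yq].
  by rewrite in_itv /= (le_trans ap py) (le_trans yq qb).
have szs : size s = n.+1 by rewrite size_mkseq.
have [x [xab /andP[px xq] hx]] := divdiff_mean_value _ _ _ _ _ p q fCn szs sab spq.
have := hs s szs us sab; rewrite hx mulrA; apply/negP; rewrite -ltNge.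
rewrite pmulr_llt0 ?invr_gt0 ?ltr0n ?fact_gt0//; apply: he => //.
rewrite /ball /= ltr_norml.
have : c - e / 2 <= p by rewrite le_max lexx orbT.
have : q <= c + e / 2 by rewrite ge_min lexx orbT.
by move=> ? ?; apply/andP; split; lra.
Qed.

Lemma divdiff_sign {R : realType} (a b : R) (n : nat) f (sigma : R) :
  a < b -> Cn_on a b n f ->
  (forall s, size s = n.+1 -> uniq s -> {in s, forall x, x \in `[a, b]} ->
    0 <= sigma * divdiff a b f s) ->
  forall s, size s = n.+1 -> {in s, forall x, x \in `[a, b]} ->
    0 <= sigma * divdiff a b f s.
Proof.
move=> ab fCn hs s szs sab.
have [x [xab _ ->]] := divdiff_mean_value _ _ _ _ _ a b fCn szs sab sab.
by rewrite mulrA divr_ge0// (derive_on_n_sign _ _ _ _ _ ab fCn hs).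
Qed.

(** * Newton's form with two multiple nodes *)

Lemma divdiff_nseq {R : realType} (a b : R) f (k : nat) (c : R) :
  divdiff a b f (nseq k.+1 c) = derive_on_n a b k f c / k`!%:R.
Proof.
rewrite /divdiff size_nseq [k.+1.-1]/=.
set t := nth _ _.
have tc i : (i <= k)%N -> t i = c.
  move=> ik; have : t i \in sort <=%R (nseq k.+1 c).
    by rewrite mem_nth// size_sort size_nseq.
  by rewrite mem_sort mem_nseq => /andP[_ /eqP].
case: k @t tc => [|k] t tc; first by rewrite /= eqxx tc.
by rewrite divdiff_sortedS !tc// eqxx.
Qed.

Lemma divdiff2 {R : realType} (a b : R) f (x y : R) : x < y ->
  divdiff a b f [:: x; y] = (f y - f x) / (y - x).
Proof.
move=> xy; rewrite /divdiff.
have -> : sort <=%R [:: x; y] = [:: x; y].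
  by apply: sorted_sort; [exact: le_trans|rewrite /= (ltW xy)].
by rewrite /= gt_eqF// !eqxx !divr1.
Qed.

(** The first [m] Newton terms involve only [c] and are Taylor terms. Afterwards [j] counts the
    copies of [d]; the exponent is [j - 1] because a Newton term omits its newest node from the
    product. *)
Lemma hermite_formula {R : realType} (a b : R) f (m k : nat) (c d x : R) :
  f x = \sum_(0 <= i < m) derive_on_n a b i f c / i`!%:R * (x - c) ^+ i
    + \sum_(1 <= j < k.+1) divdiff a b f (nseq m c ++ nseq j d)
        * ((x - c) ^+ m * (x - d) ^+ (j - 1))
    + divdiff a b f (rcons (nseq m c ++ nseq k d) x)
        * ((x - c) ^+ m * (x - d) ^+ k).
Proof.
have hw i j : (nodal_poly (nseq i c ++ nseq j d)).[x] = (x - c) ^+ i * (x - d) ^+ j.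
  rewrite /nodal_poly big_cat /= hornerM !horner_prod.
  by rewrite !big_nseq !hornerXsubC !iter_mulr_1.
rewrite {1}(newton_formula a b f (nseq m c ++ nseq k d) x) hw; congr (_ + _).
rewrite size_cat !size_nseq -(big_mkord predT (fun i =>
  divdiff a b f (take i.+1 (nseq m c ++ nseq k d)) *
  (nodal_poly (take i (nseq m c ++ nseq k d))).[x])).
rewrite (big_cat_nat (leq0n m) (leq_addr k m)) /=; congr (_ + _).
  apply: eq_big_nat => i /andP[_ im].
  rewrite !takel_cat ?size_nseq//; last exact: ltnW.
  rewrite !take_nseq ?(ltnW im)// divdiff_nseq.
  by have := hw i 0%N; rewrite cats0 expr0 mulr1 => ->.
(* Both sums are shifted to start at [0]: the Newton index becomes [i + m] and [j] becomes
   [i.+1]. *)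
rewrite -[X in \sum_(X <= _ < m + k) _]add0n big_addn addKn big_add1 /=.
apply: eq_big_nat => i /andP[_ ik]; rewrite subn1 /= -hw.
have tE l : (l <= k)%N ->
    take (l + m) (nseq m c ++ nseq k d) = nseq m c ++ nseq l d.
  move=> lk; rewrite take_cat size_nseq ltnNge leq_addl /= addnK.
  by rewrite take_nseq.
by rewrite -addSn !tE// ltnW.
Qed.

(** * Positive functionals *)

(** Since [A] is constrained only on [L], membership has to travel with each computed value. *)
Definition has_value {R : realType} {E : Type} (L : set (E -> R))
    (A : (E -> R) -> R) (u : E -> R) (r : R) : Prop := L u /\ A u = r.

Lemma has_value_lin {R : realType} {E : Type} (L : set (E -> R)) A c u v r s :
  function_space L -> normalized_positive_functional L A ->
  has_value L A u r -> has_value L A v s ->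
  has_value L A (c *: u + v) (c * r + s).
Proof.
move=> hL hA [Lu <-] [Lv <-].
by split; [exact: (function_space_lin hL)|exact: (functional_lin hA)].
Qed.

Lemma has_value0 {R : realType} {E : Type} (L : set (E -> R)) A :
  function_space L -> normalized_positive_functional L A -> has_value L A 0 0.
Proof.
move=> hL hA; have h1 : has_value L A (cst 1) 1.
  by split; [exact: (function_space_one hL)|exact: (functional_one hA)].
have := has_value_lin _ _ (-1) _ _ _ _ hL hA h1 h1.
by rewrite scaleN1r mulN1r !addNr.
Qed.

Lemma has_value_sum {R : realType} {E : Type} (L : set (E -> R)) A
    (m n : nat) (c : nat -> R) (F : nat -> E -> R) :
  function_space L -> normalized_positive_functional L A ->
  (forall k, (m <= k < n)%N -> L (F k)) ->
  has_value L A (\sum_(m <= k < n) c k *: F k) (\sum_(m <= k < n) c k * A (F k)).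
Proof.
move=> hL hA LF; rewrite big_nat_cond [X in has_value _ _ _ X]big_nat_cond.
apply: (big_ind2 (has_value L A)).
- exact: has_value0.
- move=> u r v s hu hv.
  by have := has_value_lin _ _ 1 _ _ _ _ hL hA hu hv; rewrite scale1r mul1r.
- move=> k /andP[/LF LFk _].
  have := has_value_lin _ _ (c k) _ _ _ _ hL hA (conj LFk erefl)
    (has_value0 _ _ hL hA).
  by rewrite !addr0.
Qed.

(** By [hermite_formula], [tau] times the remainder at [g t] is a nonnegative function of [t];
    positivity and linearity of [A] give the bound. *)
Lemma functional_hermite {R : realType} {E : Type} (L : set (E -> R))
    (A : (E -> R) -> R) (a b : R) (n m : nat) (f : R -> R) (g : E -> R)
    (c d tau : R) :
  function_space L -> normalized_positive_functional L A ->
  (2 <= m)%N -> L g -> L (f \o g) -> (forall t, g t \in `[a, b]) ->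
  (forall k, (2 <= k < m)%N -> L ((g - cst c) ^+ k)) ->
  (forall k, (1 <= k <= n - m)%N ->
     L ((g - cst c) ^+ m * (g - cst d) ^+ (k - 1))) ->
  {in `[a, b], forall x, 0 <= tau *
    (divdiff a b f (rcons (nseq m c ++ nseq (n - m) d) x)
      * ((x - c) ^+ m * (x - d) ^+ (n - m)))} ->
  0 <= tau * (A (f \o g) - (f c + derive_on_n a b 1 f c * (A g - c)
    + \sum_(2 <= k < m) derive_on_n a b k f c / k`!%:R * A ((g - cst c) ^+ k)
    + \sum_(1 <= k < (n - m).+1) divdiff a b f (nseq m c ++ nseq k d)
        * A ((g - cst c) ^+ m * (g - cst d) ^+ (k - 1)))).
Proof.
move=> hL hA m2 Lg Lfg gab Lc Lcd hrem.
have lin := has_value_lin L A _ _ _ _ _ hL hA.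
have h1 : has_value L A (cst 1) 1.
  by split; [exact: (function_space_one hL)|exact: (functional_one hA)].
have hg : has_value L A g (A g) by [].
have hfg : has_value L A (f \o g) (A (f \o g)) by [].
have h0 := has_value0 _ _ hL hA.
have hS := has_value_sum L A 2 m
  (fun k => derive_on_n a b k f c / k`!%:R) _ hL hA Lc.
have hT := has_value_sum L A 1 (n - m).+1
  (fun k => divdiff a b f (nseq m c ++ nseq k d)) _ hL hA Lcd.
set S := (X in has_value _ _ X _) in hS; set T := (X in has_value _ _ X _) in hT.
(* The expansion is nested to fit the shape [c *: u + v] of [lin]; in the next line [h0] supplies a
   zero summand so that scaling by [tau] fits it too. *)
have hlow := lin (f c) _ _ _ _ h1
  (lin (derive_on_n a b 1 f c) _ _ _ _ (lin (- c) _ _ _ _ h1 hg)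
     (lin 1 _ _ _ _ hS hT)).
have [Lh Ah] := lin tau _ _ _ _ (lin (- 1) _ _ _ _ hlow hfg) h0.
set h := (X in L X) in Lh.
rewrite [leRHS](_ : _ = A h); last by rewrite Ah; ring.
apply: (functional_ge0 hA) => // t.
suff -> : h t = tau * (divdiff a b f (rcons (nseq m c ++ nseq (n - m) d) (g t))
      * ((g t - c) ^+ m * (g t - d) ^+ (n - m))) by exact: hrem.
have St : S t = \sum_(2 <= k < m) derive_on_n a b k f c / k`!%:R * (g t - c) ^+ k.
  rewrite /S fct_sumE; apply: eq_bigr => k _.
  by rewrite scalrfctE exprfctE.
have Tt : T t = \sum_(1 <= k < (n - m).+1) divdiff a b f (nseq m c ++ nseq k d)
    * ((g t - c) ^+ m * (g t - d) ^+ (k - 1)).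
  rewrite /T fct_sumE; apply: eq_bigr => k _.
  by rewrite scalrfctE mulrfctE !exprfctE.
have -> : h t = tau * (f (g t) -
    (f c + derive_on_n a b 1 f c * (g t - c) + S t + T t)).
  rewrite -[LHS]/(tau * (-1 * (f c * 1 + (derive_on_n a b 1 f c *
     (- c * 1 + g t) + (1 * S t + T t))) + f (g t)) + 0); ring.
congr (_ * _); rewrite [X in X - _](hermite_formula a b f m (n - m) c d) -Tt.
(* The Taylor terms of orders [0] and [1] are split off, since [S] starts at order [2]. *)
rewrite big_ltn ?(ltn_trans _ m2)// big_ltn// -St expr0 expr1 !divr1 /=; ring.
Qed.

(** * Sign of the remainder and the two bounds *)

Lemma hermite_remainder_sign {R : realType} (a b : R) (n m : nat) f (sigma : R) :
  a < b -> Cn_on a b n f -> (m <= n)%N ->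
  (forall s, size s = n.+1 -> uniq s -> {in s, forall x, x \in `[a, b]} ->
    0 <= sigma * divdiff a b f s) ->
  {in `[a, b], forall x,
    0 <= sigma * (-1) ^+ (n - m)
           * (divdiff a b f (rcons (nseq m a ++ nseq (n - m) b) x)
              * ((x - a) ^+ m * (x - b) ^+ (n - m))) /\
    0 <= sigma * (-1) ^+ m
           * (divdiff a b f (rcons (nseq m b ++ nseq (n - m) a) x)
              * ((x - b) ^+ m * (x - a) ^+ (n - m)))}.
Proof.
move=> ab fCn mn hs x xab; have := xab; rewrite in_itv /= => /andP[ax xb].
have D0 c d : c \in `[a, b] -> d \in `[a, b] ->
    0 <= sigma * divdiff a b f (rcons (nseq m c ++ nseq (n - m) d) x).
  move=> cab dab; apply: (divdiff_sign _ _ _ _ _ ab fCn hs).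
    by rewrite size_rcons size_cat !size_nseq subnKC.
  move=> y; rewrite mem_rcons inE mem_cat !mem_nseq.
  by case/or3P => [/eqP ->|/andP[_ /eqP ->]|/andP[_ /eqP ->]].
have aab : a \in `[a, b] by rewrite in_itv /= lexx ltW.
have bab : b \in `[a, b] by rewrite in_itv /= lexx ltW.
have xa k : 0 <= (x - a) ^+ k by rewrite exprn_ge0 ?subr_ge0.
(* This is the power [(b - x) ^+ k]: the sign attached to each remainder is absorbed by its power of
   [x - b]. *)
have bx k : 0 <= (-1) ^+ k * (x - b) ^+ k.
  by rewrite -exprMn mulN1r opprB exprn_ge0 ?subr_ge0.
split.
- rewrite [leRHS](_ : _ = sigma * divdiff a b f (rcons (nseq m a ++ nseq (n - m) b) x)
    * (x - a) ^+ m * ((-1) ^+ (n - m) * (x - b) ^+ (n - m))); last by ring.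
  by apply: mulr_ge0 => //; apply: mulr_ge0 => //; exact: D0.
- rewrite [leRHS](_ : _ = sigma * divdiff a b f (rcons (nseq m b ++ nseq (n - m) a) x)
    * ((-1) ^+ m * (x - b) ^+ m) * (x - a) ^+ (n - m)); last by ring.
  by apply: mulr_ge0 => //; apply: mulr_ge0 => //; exact: D0.
Qed.

Theorem corollary2p1 (R : realType) (E : Type) (E_neq0 : [set: E] !=set0)
  (L : set (E -> R)) (hL : function_space L)
  (A : (E -> R) -> R) (hA : normalized_positive_functional L A)
  (a b : R) (ab : a < b) (n m : nat) (n_odd : odd n)
  (m_ge3 : (3 <= m)%N) (m_le : (m <= n - 1)%N)
  (f : R -> R) (fCn : Cn_on a b n f)
  (g : E -> R) (gL : L g) (gE : forall t, g t \in `[a, b]) (fgL : L (f \o g))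
  (* every function to which A is applied belongs to L *)
  (La : forall k, (2 <= k < m)%N -> L ((g - cst a) ^+ k))
  (Lb : forall k, (2 <= k < m)%N -> L ((g - cst b) ^+ k))
  (Lab : forall k, (1 <= k <= n - m)%N ->
     L ((g - cst a) ^+ m * (g - cst b) ^+ (k - 1)))
  (Lba : forall k, (1 <= k <= n - m)%N ->
     L ((g - cst b) ^+ m * (g - cst a) ^+ (k - 1))) :
  let lhs :=
    (A g - a) * (divdiff a b f [:: a; a] - divdiff a b f [:: a; b])
    + \sum_(2 <= k < m) derive_on_n a b k f a / k`!%:R * A ((g - cst a) ^+ k)
    + \sum_(1 <= k < (n - m).+1) divdiff a b f (nseq m a ++ nseq k b)
        * A ((g - cst a) ^+ m * (g - cst b) ^+ (k - 1)) in
  let rhs :=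
    (b - A g) * (divdiff a b f [:: a; b] - divdiff a b f [:: b; b])
    + \sum_(2 <= k < m) derive_on_n a b k f b / k`!%:R * A ((g - cst b) ^+ k)
    + \sum_(1 <= k < (n - m).+1) divdiff a b f (nseq m b ++ nseq k a)
        * A ((g - cst b) ^+ m * (g - cst a) ^+ (k - 1)) in
  (nconvex a b n f /\ odd m \/ nconcave a b n f /\ ~~ odd m ->
     lhs <= LR f g a b A /\ LR f g a b A <= rhs) /\
  (nconvex a b n f /\ ~~ odd m \/ nconcave a b n f /\ odd m ->
     LR f g a b A <= lhs /\ rhs <= LR f g a b A).
Proof.
move=> lhs rhs; have ba0 : b - a != 0 by rewrite subr_eq0 gt_eqF.
have m2 : (2 <= m)%N by exact: ltnW.
have mn : (m <= n)%N by rewrite (leq_trans m_le) ?leq_subr.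
(* The chord subtracted in [LR] equals [f a + f[a,b] * (A g - a)]; its slope term cancels against
   the one in [lhs], leaving the Taylor terms of orders [0] and [1] at [a]. At [b] the chord is
   expanded from [f b] instead. *)
have LRl : LR f g a b A - lhs = A (f \o g) - (f a + derive_on_n a b 1 f a * (A g - a)
    + \sum_(2 <= k < m) derive_on_n a b k f a / k`!%:R * A ((g - cst a) ^+ k)
    + \sum_(1 <= k < (n - m).+1) divdiff a b f (nseq m a ++ nseq k b)
        * A ((g - cst a) ^+ m * (g - cst b) ^+ (k - 1))).
  rewrite /lhs /LR -[[:: a; a]]/(nseq 2 a) divdiff_nseq divdiff2// divr1.
  by field.
have LRr : LR f g a b A - rhs = A (f \o g) - (f b + derive_on_n a b 1 f b * (A g - b)
    + \sum_(2 <= k < m) derive_on_n a b k f b / k`!%:R * A ((g - cst b) ^+ k)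
    + \sum_(1 <= k < (n - m).+1) divdiff a b f (nseq m b ++ nseq k a)
        * A ((g - cst b) ^+ m * (g - cst a) ^+ (k - 1))).
  rewrite /rhs /LR -[[:: b; b]]/(nseq 2 b) divdiff_nseq divdiff2// divr1.
  by field.
have key sigma :
    (forall s, size s = n.+1 -> uniq s -> {in s, forall x, x \in `[a, b]} ->
      0 <= sigma * divdiff a b f s) ->
    0 <= sigma * (-1) ^+ (n - m) * (LR f g a b A - lhs) /\
    0 <= sigma * (-1) ^+ m * (LR f g a b A - rhs).
  move=> /(hermite_remainder_sign _ _ _ _ _ _ ab fCn mn) hs.
  rewrite LRl LRr; split; apply: (functional_hermite L) => // x xab.
  - exact: (hs x xab).1.
  - exact: (hs x xab).2.
have convex_key : nconvex a b n f ->
    0 <= (-1) ^+ (n - m) * (LR f g a b A - lhs) /\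
    0 <= (-1) ^+ m * (LR f g a b A - rhs).
  move=> fc; have := key 1; rewrite !mul1r; apply => s szs us sab.
  by rewrite mul1r; apply: fc.
have concave_key : nconcave a b n f ->
    0 <= - (-1) ^+ (n - m) * (LR f g a b A - lhs) /\
    0 <= - (-1) ^+ m * (LR f g a b A - rhs).
  move=> fc; have := key (-1); rewrite !mulN1r; apply => s szs us sab.
  by rewrite mulN1r -divdiff_opp ?szs//; apply: fc.
(* As [n] is odd, [n - m] and [m] have opposite parities, so the two remainders have opposite signs
   and [LR] is enclosed between the two sums. *)
rewrite -(signr_odd _ (n - m)) -(signr_odd _ m) oddB// n_odd /= in convex_key concave_key.
split=> -[] [hf hm]; rewrite ?hm ?(negPf hm) /= in convex_key concave_key;
  [have [] := convex_key hf|have [] := concave_key hf|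
   have [] := convex_key hf|have [] := concave_key hf];
  rewrite ?expr0 ?expr1 ?opprK ?mulN1r ?mul1r; split; lra.
Qed.
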